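(* Let $V$ be a simple vertex operator algebra and $G$ a finite subgroup of $\mathrm{Aut}(V)$. Then $\mathrm{Gal}(V/V^G)=G$.
   Context: $V^G=\{v\in V: gv=v\ \forall g\in G\}$. For a vertex operator subalgebra $U\subseteq V$, the Galois group is $\mathrm{Gal}(V/U)=\{g\in\mathrm{Aut}(V): g|_U=\mathrm{id}\}$, where $\mathrm{Aut}(V)$ is the group of vertex operator algebra automorphisms of $V$. *)

(* Defs.v *)
(* Vertex operator algebras over an algebraically closed
   field of characteristic 0 (standing in for C), following Frenkel-Lepowsky-Meurman,
   with vertex operators encoded through their modes: Y(u,z) = sum_n u_n z^{-n-1},
   u_n w = mode u n w. *)
From HB Require Import structures.
From mathcomp Require Import all_boot all_order all_algebra all_fingroup.
Set Implicit Arguments. Unset Strict Implicit. Unset Printing Implicit Defensive.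
Import Order.TTheory GRing.Theory Num.Theory.
Local Open Scope ring_scope.

Definition gbin (F : fieldType) (p : int) (i : nat) : F :=
  (\prod_(j < i) (p%:~R - (j : nat)%:R)) / (i`!)%:R.

Definition linear_map (F : fieldType) (V : lmodType F) (g : V -> V) : Prop :=
  forall (a : F) (u v : V), g (a *: u + v) = a *: g u + g v.

Record VOA (F : fieldType) (V : lmodType F) := MkVOA {
  vac : V;
  omega : V;
  mode : V -> int -> V -> V;
  cc : F;
  mode_linl : forall n w (a : F) u u', mode (a *: u + u') n w = a *: mode u n w + mode u' n w;
  mode_linr : forall u n (a : F) w w', mode u n (a *: w + w') = a *: mode u n w + mode u n w';
  truncation : forall u w, exists N : int, forall n, N <= n -> mode u n w = 0;
  (* vacuum: Y(1,z) = id *)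
  vacuum_id : forall n w, mode vac n w = if n == -1 then w else 0;
  (* creation: Y(u,z)1 in V[[z]] with constant term u *)
  creation_pos : forall u n, 0 <= n -> mode u n vac = 0;
  creation_cst : forall u, mode u (-1) vac = u;
  (* Jacobi identity in its component (Borcherds) form; the (a priori infinite)
     sums are cut at any K beyond which all summands vanish *)
  jacobi : forall u v w (p q r : int) (K : nat),
    (forall i : nat, (K <= i)%N ->
       [/\ mode u (r + i%:Z) v = 0, mode v (q + i%:Z) w = 0 & mode u (p + i%:Z) w = 0]) ->
    \sum_(i < K) gbin F p i *: mode (mode u (r + i%:Z) v) (p + q - i%:Z) w =
    \sum_(i < K) ((-1) ^+ i * gbin F r i) *:
        (mode u (p + r - i%:Z) (mode v (q + i%:Z) w)
         - ((-1) ^ r) *: mode v (q + r - i%:Z) (mode u (p + i%:Z) w));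
  (* Virasoro relations, L(n) = omega_{n+1} *)
  virasoro : forall (m n : int) v,
    mode omega (m + 1) (mode omega (n + 1) v) - mode omega (n + 1) (mode omega (m + 1) v) =
    (m - n)%:~R *: mode omega (m + n + 1) v
    + (if m + n == 0 then ((m ^+ 3 - m)%:~R / 12%:R) * cc else 0) *: v;
  (* L(-1)-derivative property: Y(L(-1)v,z) = d/dz Y(v,z) *)
  derivative : forall v n w, mode (mode omega 0 v) n w = - (n%:~R) *: mode v (n - 1) w;
  (* grading V = (+)_{n in Z} V_n, V_n = {v | L(0) v = n v} *)
  graded : forall v, exists s : seq (int * V),
    (forall x, x \in s -> mode omega 1 x.2 = (x.1)%:~R *: x.2) /\ v = \sum_(x <- s) x.2;
  grade_findim : forall n : int, exists s : seq V, forall v,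
    mode omega 1 v = n%:~R *: v -> exists c : 'I_(size s) -> F, v = \sum_(i < size s) c i *: s`_i;
  grade_bounded : exists N : int, forall (n : int) v,
    n < N -> mode omega 1 v = n%:~R *: v -> v = 0
}.

Definition is_subspace (F : fieldType) (V : lmodType F) (I : V -> Prop) : Prop :=
  I 0 /\ forall (a : F) u v, I u -> I v -> I (a *: u + v).

Definition is_ideal (F : fieldType) (V : lmodType F) (A : VOA V) (I : V -> Prop) : Prop :=
  is_subspace I /\ forall u w n, I w -> I (mode A u n w) /\ I (mode A w n u).

Definition simple_VOA (F : fieldType) (V : lmodType F) (A : VOA V) : Prop :=
  forall I : V -> Prop, is_ideal A I -> (forall v, I v -> v = 0) \/ (forall v, I v).

Definition is_VOA_aut (F : fieldType) (V : lmodType F) (A : VOA V) (g : V -> V) : Prop :=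
  [/\ linear_map g, bijective g,
      forall u n w, g (mode A u n w) = mode A (g u) n (g w)
    & g (omega A) = omega A].

(* a finite subgroup G of Aut(V), given as the image of a finite group H acting on V *)
Definition voa_group_action (F : fieldType) (V : lmodType F) (A : VOA V)
    (gT : finGroupType) (H : {group gT}) (rho : gT -> V -> V) : Prop :=
  (forall x, x \in H -> is_VOA_aut A (rho x)) /\
  (forall x y, x \in H -> y \in H -> forall v, rho (x * y)%g v = rho x (rho y v)).

Definition fixed_pts (F : fieldType) (V : lmodType F)
    (gT : finGroupType) (H : {group gT}) (rho : gT -> V -> V) (v : V) : Prop :=
  forall x, x \in H -> rho x v = v.

Definition in_Gal (F : fieldType) (V : lmodType F) (A : VOA V) (U : V -> Prop) (h : V -> V) : Prop :=
  is_VOA_aut A h /\ forall v, U v -> h v = v.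

(* Main.v *)
(* Dedekind's independence of characters, with vertex operators as coefficients.
   In a simple vertex operator algebra [Y(b,z)c = 0] forces [b = 0] or [c = 0],
   because [{b | Y(b,z)c = 0}] is an ideal. Consequently, if
   [sum_i Y(b_i,z) s_i = 0] for endomorphisms [s_i], then substituting [Y(u,z')w]
   and subtracting [Y(s_1 u,z')] times the relation eliminates [s_1] by locality
   and associativity, leaving the coefficients [(b_i)_n (s_i u - s_1 u)]; hence the
   coefficient of an endomorphism different from all the others is zero.
   If [h] fixes [V^G] pointwise, then [h \o T = T] for [T = sum_(g in G) g], and
   this relation between the [h \o g] and the [g] is impossible unless [h] is some [g]. *)
Require Import Defs.
From HB Require Import structures.
From mathcomp Require Import all_boot all_order all_algebra all_fingroup.
From mathcomp Require Import zify.
From Stdlib Require Import Classical ClassicalEpsilon.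
Import Order.TTheory GRing.Theory Num.Theory.
Local Open Scope ring_scope.

(** Suits statements about modes: truncation supplies the base case at all large indices. *)
Lemma int_descending_ind (P : int -> Prop) (N : int) :
  (forall n : int, N <= n -> P n) ->
  (forall n : int, (forall m : int, n < m -> P m) -> P n) ->
  forall n, P n.
Proof.
move=> PN Pstep n.
have Pk (k : nat) : forall m, N - k%:Z <= m -> P m.
  elim: k => [|k IHk] m lem; first by apply: PN; lia.
  by apply: Pstep => m' ltm; apply: IHk; lia.
by apply: (Pk `|N - n|%N); lia.
Qed.

Lemma gbin0 (F : fieldType) (p : int) : gbin F p 0 = 1.
Proof. by rewrite /gbin big_ord0 fact0 divr1. Qed.

Section Modes.

Context {F : fieldType} {V : lmodType F} (A : VOA V).

Lemma modeBl u u' n w : mode A (u - u') n w = mode A u n w - mode A u' n w.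
Proof. by rewrite addrC -scaleN1r mode_linl scaleN1r addrC. Qed.

Lemma mode0l n w : mode A 0 n w = 0.
Proof. by rewrite -[X in mode A X](subrr (0 : V)) modeBl subrr. Qed.

Lemma modeZl a u n w : mode A (a *: u) n w = a *: mode A u n w.
Proof. by rewrite -[a *: u]addr0 mode_linl mode0l addr0. Qed.

Lemma modeDr u n w w' : mode A u n (w + w') = mode A u n w + mode A u n w'.
Proof. by rewrite -[w]scale1r mode_linr !scale1r. Qed.

Lemma mode0r u n : mode A u n 0 = 0.
Proof. by apply: (addIr (mode A u n 0)); rewrite -modeDr !add0r. Qed.

Lemma mode_sumr (I : Type) (s : seq I) u n (f : I -> V) :
  mode A u n (\sum_(i <- s) f i) = \sum_(i <- s) mode A u n (f i).
Proof. exact: (big_morph _ (modeDr u n) (mode0r u n)). Qed.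

Lemma mode_cst_eq0 u : (forall n, mode A u n (vac A) = 0) -> u = 0.
Proof. by move=> u0; rewrite -(creation_cst A u) u0. Qed.

Lemma truncation_seq {I : eqType} (s : seq I) (f g : I -> V) :
  exists N : nat, forall i (n : int), i \in s -> N%:Z <= n -> mode A (f i) n (g i) = 0.
Proof.
elim: s => [|i s [N HN]]; first by exists 0%N.
have [M HM] := truncation A (f i) (g i).
exists (N + `|M|)%N => j n; rewrite inE => /orP[/eqP->|js] len.
  by apply: HM; lia.
by apply: HN => //; lia.
Qed.

(** Since [s] is finite, truncation gives one cutoff valid for all its entries. The bound is a
    successor so that the term [j = 0] can be split off. *)
Lemma jacobi_sum {I : eqType} (s : seq I) (b d x : I -> V) (p q r : int) :
  exists K : nat,
    \sum_(j < K.+1) gbin F p j *: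
        (\sum_(i <- s) mode A (mode A (b i) (r + j%:Z) (d i)) (p + q - j%:Z) (x i)) =
    \sum_(j < K.+1) ((-1) ^+ j * gbin F r j) *:
        ((\sum_(i <- s) mode A (b i) (p + r - j%:Z) (mode A (d i) (q + j%:Z) (x i)))
         - ((-1) ^ r) *: (\sum_(i <- s) mode A (d i) (q + r - j%:Z)
                                          (mode A (b i) (p + j%:Z) (x i)))).
Proof.
have [N1 H1] := truncation_seq s b d; have [N2 H2] := truncation_seq s d x.
have [N3 H3] := truncation_seq s b x.
exists (N1 + N2 + N3 + `|p| + `|q| + `|r|)%N; set K := _.+1.
under eq_bigr do rewrite scaler_sumr.
rewrite exchange_big /=.
under [RHS]eq_bigr do rewrite (scaler_sumr ((-1) ^ r)) -sumrB scaler_sumr.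
rewrite [RHS]exchange_big /=.
rewrite big_seq [RHS]big_seq; apply: eq_bigr => i si.
apply: jacobi => j leKj.
by split; [apply: H1 | apply: H2 | apply: H3] => //; move: leKj; rewrite /K; lia.
Qed.

(* Locality; the descent on the inner mode undoes the factor [(z1 - z2)^r]. *)
Lemma sum_mode_annihilator {I : eqType} (s : seq I) (b x : I -> V) :
  (forall n, \sum_(i <- s) mode A (b i) n (x i) = 0) ->
  forall c m n, \sum_(i <- s) mode A (b i) m (mode A c n (x i)) = 0.
Proof.
move=> bx0 c m n; move: n m.
have [N1 H1] := truncation_seq s b (fun=> c).
have [N2 H2] := truncation_seq s (fun=> c) x.
apply: (int_descending_ind _ N2%:Z) => [n len m|n IHn m].
  by rewrite big1_seq // => i /andP[_ si]; rewrite H2 // mode0r.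
(* With [r = N1] all products of [b i] with [c] on the left vanish. As [p + r = m] and [q = n], the
   wanted sum is the term [j = 0] on the right; later terms have inner mode [n + j], covered by
   induction. *)
have [K] := jacobi_sum s b (fun=> c) x (m - N1%:Z) n N1%:Z.
rewrite big1 => [|j _]; last first.
  rewrite big1_seq ?scaler0 // => i /andP[_ si].
  by rewrite H1 ?mode0l //; lia.
rewrite big_ord_recl [X in _ + X]big1 => [|j _]; last first.
  by rewrite /= IHn ?sub0r -?mode_sumr ?bx0 ?mode0r ?scaler0 ?oppr0 ?scaler0 //= /bump; lia.
rewrite /= -mode_sumr bx0 mode0r scaler0 subr0 addr0 expr0 gbin0 mulr1 scale1r.
by rewrite subrK subr0 addr0 => <-.
Qed.

(* Associativity; the descent on the inner mode undoes the factor [(z0 + z2)^p]. *)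
Lemma sum_mode_assoc {I : eqType} (s : seq I) (b d x : I -> V) :
  (forall m n, \sum_(i <- s) mode A (b i) m (mode A (d i) n (x i)) = 0) ->
  forall n m, \sum_(i <- s) mode A (mode A (b i) n (d i)) m (x i) = 0.
Proof.
move=> bdx0.
have [N1 H1] := truncation_seq s b d; have [N2 H2] := truncation_seq s b x.
apply: (int_descending_ind _ N1%:Z) => [n len m|n IHn m].
  by rewrite big1_seq // => i /andP[_ si]; rewrite H1 // mode0l.
(* With [p = N2] the modes [p + j] of [b i] kill [x i], so the right side vanishes. As [r = n] and
   [p + q = m], the wanted sum is the term [j = 0] on the left. *)
have [K] := jacobi_sum s b d x N2%:Z (m - N2%:Z) n.
rewrite [RHS]big1 => [|j _]; last first.
  rewrite bdx0 big1_seq ?scaler0 ?subr0 ?scaler0 // => i /andP[_ si].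
  by rewrite H2 ?mode0r //; lia.
rewrite big_ord_recl [X in _ + X]big1 => [|j _]; last first.
  by rewrite IHn ?scaler0 //= /bump; lia.
by rewrite /= gbin0 scale1r !addr0 addrC subrK => ->.
Qed.

Lemma simple_mode_eq0 (hsimple : simple_VOA A) b c :
  (forall n, mode A b n c = 0) -> c != 0 -> b = 0.
Proof.
move=> bc0 cn0; pose J v := forall n, mode A v n c = 0.
have assoc u v : (forall m n, mode A u m (mode A v n c) = 0) ->
    forall n m, mode A (mode A u n v) m c = 0.
  move=> uv0 n m.
  have := sum_mode_assoc [:: tt] (fun=> u) (fun=> v) (fun=> c) _ n m.
  by rewrite big_seq1; apply => m' n'; rewrite big_seq1.
have idealJ : is_ideal A J.
  split; first split.
  - by move=> n; rewrite mode0l.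
  - by move=> a u v Ju Jv n; rewrite mode_linl Ju Jv scaler0 addr0.
  (* Products with [w] on the right are immediate, as [w] kills [c]; with [w] on the left, locality
     moves [w] past [u] first. *)
  move=> u w n Jw; split; apply: assoc => m k; first by rewrite Jw mode0r.
  have := sum_mode_annihilator [:: tt] (fun=> w) (fun=> c) _ u m k.
  by rewrite big_seq1; apply => n'; rewrite big_seq1.
have [J0|JT] := hsimple J idealJ; first exact: J0.
by have := JT (vac A) (-1); rewrite vacuum_id eqxx => /eqP; rewrite (negPf cn0).
Qed.

(** Only [sigma i0] has to differ from the other maps, which may repeat: this allows actions that
    are not faithful. The preimage of the vacuum settles the empty list through creation. *)
Lemma mode_dedekind (hsimple : simple_VOA A) {I : eqType} (i0 : I) (s : seq I)
    (sigma : I -> V -> V) (b : I -> V) :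
  (forall i u n w, i \in i0 :: s ->
     sigma i (mode A u n w) = mode A (sigma i u) n (sigma i w)) ->
  (exists w, sigma i0 w = vac A) ->
  (forall i, i \in s -> ~ (sigma i =1 sigma i0)) ->
  (forall n w, \sum_(i <- i0 :: s) mode A (b i) n (sigma i w) = 0) ->
  b i0 = 0.
Proof.
move=> + [w0 w0E]; elim: s b => [|i1 s IHs] b homs neqs rel.
  apply: mode_cst_eq0 => n.
  by have := rel n w0; rewrite big_seq1 w0E.
apply/eqP/negP => /negP b0; apply: (neqs i1); rewrite ?mem_head // => u.
apply/eqP/negP => /negP neq_u; case/eqP: b0.
(* Once [i1] is eliminated, the coefficient at [i0] is a mode of [b i0] applied to this nonzero
   vector. *)
apply: (simple_mode_eq0 hsimple _ (sigma i0 u - sigma i1 u)); last first.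
  by rewrite subr_eq0 eq_sym.
move=> n; pose d i := sigma i u - sigma i1 u.
apply: (IHs (fun i => mode A (b i) n (d i))) => [i v m w si|i si|m w].
- by apply: homs; move: si; rewrite !inE => /orP[->|->]; rewrite ?orbT.
- by apply: neqs; rewrite inE si orbT.
have homs' i v k w' : i \in [:: i0, i1 & s] ->
  mode A (sigma i v) k (sigma i w') = sigma i (mode A v k w').
  by move=> si; rewrite homs.
have d1 : d i1 = 0 by rewrite /d subrr.
suff : \sum_(i <- [:: i0, i1 & s]) mode A (mode A (b i) n (d i)) m (sigma i w) = 0.
  by rewrite !big_cons d1 mode0r mode0l add0r.
apply: sum_mode_assoc => {}m k.
have -> : \sum_(i <- [:: i0, i1 & s]) mode A (b i) m (mode A (d i) k (sigma i w)) =
  \sum_(i <- [:: i0, i1 & s]) mode A (b i) m (sigma i (mode A u k w)) -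
  \sum_(i <- [:: i0, i1 & s]) mode A (b i) m (mode A (sigma i1 u) k (sigma i w)).
  rewrite -sumrB big_seq [RHS]big_seq; apply: eq_bigr => i si.
  by rewrite modeBl homs' // addrC -scaleN1r mode_linr scaleN1r addrC.
rewrite rel sum_mode_annihilator ?subr0 // => n'; exact: rel.
Qed.

Lemma vac_eq0 : vac A = 0 -> forall v : V, v = 0.
Proof. by move=> vac0 v; rewrite -(creation_cst A v) vac0 mode0r. Qed.

End Modes.

Lemma is_VOA_aut_eq (F : fieldType) (V : lmodType F) (A : VOA V) (g h : V -> V) :
  g =1 h -> is_VOA_aut A g -> is_VOA_aut A h.
Proof.
move=> gh [lin bij hom om]; split.
- by move=> a u v; rewrite -!gh lin.
- exact: eq_bij bij _ gh.
- by move=> u n w; rewrite -!gh hom.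
by rewrite -gh.
Qed.

Lemma linear_map_sum (F : fieldType) (V : lmodType F) (g : V -> V) (I : Type)
    (s : seq I) (P : pred I) (f : I -> V) :
  linear_map g -> g (\sum_(i <- s | P i) f i) = \sum_(i <- s | P i) g (f i).
Proof.
move=> lin; have gD u v : g (u + v) = g u + g v.
  by have := lin 1 u v; rewrite !scale1r.
apply: (big_morph _ gD); by apply: (addIr (g 0)); rewrite -gD !add0r.
Qed.

Section GroupAction.

Context {F : closedFieldType} {V : lmodType F} (A : VOA V).
Context {gT : finGroupType} (H : {group gT}) (rho : gT -> V -> V).
Context (hrho : voa_group_action A H rho).

(** The map [rho 1] is idempotent and injective. *)
Lemma action1 v : rho 1%g v = v.
Proof.
case: hrho => autH morH; have [_ bij _ _] := autH _ (group1 H).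
by apply: (bij_inj bij); rewrite -morH ?group1 // mulg1.
Qed.

Lemma fixed_pts_trace w : fixed_pts H rho (\sum_(x in H) rho x w).
Proof.
case: hrho => autH morH y Hy; have [lin _ _ _] := autH _ Hy.
rewrite linear_map_sum // [RHS](reindex_inj (mulgI y)) /=.
by apply: eq_big => [x|x Hx]; rewrite ?groupMl ?morH.
Qed.

End GroupAction.

Theorem theorem6p9 (F : closedFieldType) (hchar : [pchar F] =i pred0)
    (V : lmodType F) (A : VOA V) (hsimple : simple_VOA A)
    (gT : finGroupType) (H : {group gT}) (rho : gT -> V -> V)
    (hrho : voa_group_action A H rho) :
  forall h : V -> V,
    in_Gal A (fixed_pts H rho) h <-> exists2 x, x \in H & forall v, h v = rho x v.
Proof.
move=> h; split; last first.
  case=> x Hx hx; split; last by move=> v fixv; rewrite hx fixv.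
  by apply: is_VOA_aut_eq (hrho.1 x Hx) => v; rewrite hx.
case=> -[lin [h' hK h'K] hom _] fixh; apply: NNPP => noth.
have hneq x : x \in H -> ~ (rho x =1 h) by move=> Hx eqx; case: noth; exists x.
(* For [x] in the kernel [K] of the action, [h \o rho x] is [h] itself. These terms are merged into
   the index [None] with coefficient [#|K|], so that [h] differs from every other map in the
   list. *)
pose isid (x : gT) : bool := excluded_middle_informative (rho x =1 id).
have isidP x : reflect (rho x =1 id) (isid x) by exact: sumboolP.
pose K := [set x in H | isid x].
pose s := [seq Some (inl x) | x in H :\: K] ++ [seq Some (inr x) | x in H] : seq (option (gT + gT)).
pose sigma i := match i with
  | None => h | Some (inl x) => h \o rho x | Some (inr x) => rho x end.
pose b (i : option (gT + gT)) := match i with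
  | None => #|K|%:R *: vac A | Some (inl x) => vac A | Some (inr x) => - vac A end.
have memK x : x \in H :\: K -> x \in H /\ ~ (rho x =1 id).
  by rewrite !inE => /andP[/[swap] Hx]; rewrite Hx => /isidP.
have b0 : b None = 0.
  apply: (mode_dedekind A hsimple None s sigma).
  - move=> i u n w; rewrite inE mem_cat => /or3P[/eqP-> //=||] /mapP[x]; rewrite mem_enum.
      by move=> /memK[Hx _] -> /=; have [_ _ homx _] := hrho.1 x Hx; rewrite homx hom.
    by move=> Hx -> /=; have [_ _ homx _] := hrho.1 x Hx; rewrite homx.
  - by exists (h' (vac A)); rewrite /= h'K.
  - move=> i; rewrite mem_cat => /orP[] /mapP[x]; rewrite mem_enum.
      move=> /memK[_ nidx] -> /= eqh; apply: nidx => v; exact: (can_inj hK) (eqh v).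
    by move=> Hx -> /=; apply: hneq.
  move=> n w; rewrite big_cons big_cat !big_map !big_enum /=.
  rewrite modeZl; under [X in _ + (_ + X)]eq_bigr do
    rewrite -sub0r modeBl mode0l sub0r.
  rewrite !vacuum_id.
  under [X in _ + (X + _)]eq_bigr do rewrite vacuum_id.
  under [X in _ + (_ + X)]eq_bigr do rewrite vacuum_id.
  (* Only the mode [-1] of the vacuum is nonzero; there the relation says that [h] fixes the trace
     of [w]. *)
  case: eqP => _; last by rewrite scaler0 !big1 ?addr0 // => ? _; rewrite oppr0.
  have -> : #|K|%:R *: h w = \sum_(x in K) h (rho x w).
    rewrite scaler_nat -sumr_const; apply: eq_bigr => x.
    by rewrite inE => /andP[_ /isidP->].
  rewrite sumrN addrA -[X in _ - X]fixh; last exact: fixed_pts_trace hrho w.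
  rewrite (linear_map_sum _ _ h _ _ _ _ lin) [X in _ - X](big_setID K) /=.
  rewrite (setIidPr _) ?subrr //.
  by apply/subsetP => x; rewrite inE => /andP[].
have K1 : 1%g \in K.
  by rewrite inE group1; apply/isidP => v; rewrite (action1 _ _ _ hrho).
case: noth; exists 1%g => // v.
(* [simple_VOA] admits the zero space, where [h] agrees with [rho 1]. Otherwise [b0] is absurd, as
   [#|K|] is positive and the characteristic is 0. *)
suff vac0 : vac A = 0 by rewrite [LHS](vac_eq0 A vac0) [RHS](vac_eq0 A vac0).
move/eqP: b0; rewrite scaler_eq0 => /orP[|/eqP//].
by rewrite ((pcharf0P F).1 hchar) cards_eq0 => /eqP K0; rewrite K0 inE in K1.
Qed.
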